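(* Let \[ c := \sum_{p} \frac{1}{p(p+1)} \prod_{p' < p} \left(1 - \frac{1}{p'}\right) \approx 0.2296, \] where $p$ runs over all primes and the product runs over all primes $p'<p$. Then, as $n \to \infty$, \[ s(n) = c\cdot n + O\!\left(\frac{n}{\log n \, \log\log n}\right). \] In particular, $\lim_{n\to\infty} s(n)/n = c$.
   Context: For a positive integer $n$, $n \bmod k$ denotes the least nonnegative remainder of $n$ upon division by $k$. Let $S(n) := \{ n \bmod k : k \in \{1,2,\ldots,\lfloor n/2\rfloor\}\}$ and $s(n) := |S(n)|$, i.e. $s(n)$ is the number of distinct values of $n \bmod k$ for $1 \le k \le \lfloor n/2 \rfloor$. *)

(* Defs.v *)
From mathcomp Require Import all_boot all_order all_algebra.
From mathcomp Require Import all_classical all_reals all_analysis.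

Set Implicit Arguments.
Unset Strict Implicit.
Unset Printing Implicit Defensive.

Import Order.TTheory GRing.Theory Num.Theory.
Import numFieldNormedType.Exports.

Local Open Scope ring_scope.

Definition remainders (n : nat) : seq nat :=
  undup [seq (n %% k)%N | k <- index_iota 1 (n %/ 2).+1].

Definition num_remainders (n : nat) : nat := size (remainders n).

Definition density_partial (R : realType) (N : nat) : R :=
  \sum_(0 <= p < N | prime p)
    (p%:R * (p%:R + 1))^-1 * \prod_(0 <= q < p | prime q) (1 - q%:R^-1).

(* [limn] is a junk value for a divergent sequence, so results about
   [density] should be read together with the convergence of
   [density_partial R]. *)
Definition density (R : realType) : R := limn (density_partial R).

(* Main.v *)
(* The residue [m = n mod k] with [k <= n / 2] amounts to an integer [N = n - m]
   having a divisor [k] with [n - N < k <= n / 2]. The largest proper divisor of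
   [N] is [N / p], [p] its least prime factor, so [N] qualifies iff
   [N > n * p / (p + 1)]. Among integers, least prime factor [p] has density
   [(1 / p) * prod_(q < p) (1 - 1 / q)], whence the constant.

   For the error term, cut at [y = floor (log n / 2)]. For [p < y] Legendre's
   sieve counts the [N] with an error [O(2^p)], in total [O(2^y) = O(sqrt n)].
   The remaining [N] exceed [n * y / (y + 1)] and have no prime factor below
   [y], so by the same sieve there are at most
   [n / (y + 1) * prod_(q < y) (1 - 1 / q) + O(2^y)] of them. The tail of the
   series for the constant is bounded by [prod_(q < y) (1 - 1 / q) / (y + 1)],
   because [(1 / p) * prod_(q < p) (1 - 1 / q)] telescopes. Finally
   [prod_(q < y) (1 - 1 / q) <= 1 / log y], by comparison with the harmonic
   sum. *)
From Stdlib Require Import NArith.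
Require Import Defs.
From mathcomp Require Import all_boot all_order all_algebra.
From mathcomp Require Import all_classical all_reals all_analysis.
From mathcomp Require Import ring lra zify.

Set Implicit Arguments.
Unset Strict Implicit.
Unset Printing Implicit Defensive.

Import Order.TTheory GRing.Theory Num.Theory.
Import numFieldNormedType.Exports.

Local Open Scope classical_set_scope.
Local Open Scope ring_scope.

(** * Integers without small prime factors *)

Definition rough (y k : nat) : bool :=
  all (fun q => prime q ==> ~~ (q %| k)%N) (iota 0 y).

Lemma roughS y k : rough y.+1 k = rough y k && (prime y ==> ~~ (y %| k)%N).
Proof. by rewrite /rough -addn1 iotaD all_cat /= andbT. Qed.

Lemma roughP y k :
  reflect (forall q, prime q -> (q < y)%N -> ~~ (q %| k)%N) (rough y k).
Proof.
apply: (iffP allP) => [h q pq qy|h q]; last first.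
  by rewrite mem_iota add0n /= => qy; apply/implyP => pq; exact: h.
by have := h q; rewrite mem_iota add0n qy pq; exact.
Qed.

Lemma rough_leq_pdiv y k : (1 < k)%N -> rough y k -> (y <= pdiv k)%N.
Proof.
move=> k1 /roughP ry; rewrite leqNgt; apply/negP => lt.
by have := ry _ (pdiv_prime k1) lt; rewrite pdiv_dvd.
Qed.

Lemma rough_dvd_pdiv p k : (1 < k)%N -> rough p k -> prime p -> (p %| k)%N ->
  pdiv k = p.
Proof.
move=> k1 rk pp pk; apply/eqP; rewrite eqn_leq rough_leq_pdiv // andbT.
by apply: pdiv_min_dvd => //; exact: prime_gt1.
Qed.

Lemma rough_mul_prime p k : prime p -> rough p (p * k) = rough p k.
Proof.
move=> pp; apply/roughP/roughP => h q pq qp.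
  by apply: contra (h q pq qp) => qk; rewrite dvdn_mull.
rewrite Euclid_dvdM // negb_or h // andbT dvdn_prime2 //.
by rewrite neq_ltn qp.
Qed.

Lemma rough_leq1 m k : (0 < k <= m)%N -> rough m.+1 k -> k = 1%N.
Proof.
move=> /andP[k0 km] /roughP rk; apply/eqP; rewrite eqn_leq k0 andbT leqNgt.
apply/negP => k1; have := rk _ (pdiv_prime k1); rewrite pdiv_dvd ltnS.
by move=> /(_ (leq_trans (pdiv_leq k0) km)).
Qed.

Lemma big_dvdn (V : nmodType) (F : nat -> V) d m : (0 < d)%N ->
  \sum_(1 <= k < m.+1 | (d %| k)%N) F k
    = \sum_(1 <= j < (m %/ d).+1) F (d * j)%N.
Proof.
move=> d0; elim: m => [|m IH]; first by rewrite div0n !big_geq.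
rewrite big_mkcond big_nat_recr //= -big_mkcond IH divnS //.
case: ifP => [dm|_]; last by rewrite addr0.
rewrite add1n [RHS]big_nat_recr //=; congr (_ + F _).
by have := divnS m d0; rewrite dm add1n => <-; rewrite mulnC divnK.
Qed.

(** One sieve step: multiplying [j] by [p] creates no prime factor below [p], so the [p]-rough
    multiples of [p] are the [p * j] with [j] itself [p]-rough. The weight [F] is general because
    counts, reciprocals and codivisor indicators are all sieved this way. *)
Lemma sum_roughS_prime (V : nmodType) (F : nat -> V) p m : prime p ->
  \sum_(1 <= k < m.+1 | rough p k) F k =
  \sum_(1 <= k < m.+1 | rough p.+1 k) F k +
  \sum_(1 <= j < (m %/ p).+1 | rough p j) F (p * j)%N.
Proof.
move=> pp; rewrite (bigID (fun k => (p %| k)%N)) /= [LHS]addrC.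
under eq_bigl do rewrite andbC -[~~ _]/(true ==> ~~ _) -{1}pp andbC -roughS.
congr (_ + _); under eq_bigl do rewrite andbC.
rewrite big_mkcondr big_dvdn ?prime_gt0 // [RHS]big_mkcond /=.
by apply: eq_bigr => j _; rewrite rough_mul_prime.
Qed.

Lemma sum_roughS_nprime (V : nmodType) (F : nat -> V) p m : ~~ prime p ->
  \sum_(1 <= k < m.+1 | rough p.+1 k) F k =
  \sum_(1 <= k < m.+1 | rough p k) F k.
Proof. by move=> /negPf pp; apply: eq_bigl => k; rewrite roughS pp andbT. Qed.

(** * Legendre's sieve, decay of the sieve density, convergence of the series *)

Section Sieve.
Variable R : realType.
Implicit Types y m n p : nat.

Definition sieve_density (y : nat) : R :=
  \prod_(0 <= q < y | prime q) (1 - q%:R^-1).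

Lemma sieve_densityS y : sieve_density y.+1 =
  if prime y then sieve_density y * (1 - y%:R^-1) else sieve_density y.
Proof.
rewrite /sieve_density big_mkcond big_nat_recr //= -big_mkcond.
by case: ifP; rewrite ?mulr1.
Qed.

Lemma prime_inv_itv p : prime p -> 0 < (p%:R^-1 : R) < 1.
Proof.
move=> pp; rewrite invr_gt0 ltr0n prime_gt0 //= invf_lt1 ?ltr0n ?prime_gt0 //.
by rewrite ltr1n prime_gt1.
Qed.

Lemma sieve_density_itv y : 0 < sieve_density y <= 1.
Proof.
elim: y => [|y /andP[h0 h1]].
  by rewrite /sieve_density big_geq // ltr01 /=.
rewrite sieve_densityS; case: ifP => [/prime_inv_itv/andP[p0 p1]|_].
  rewrite mulr_gt0 ?subr_gt0 //=.
  by rewrite mulr_ile1 ?(ltW h0) ?subr_ge0 ?(ltW p1) ?gerBl ?(ltW p0).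
by rewrite h0.
Qed.

Definition rough_count (y m : nat) : R := \sum_(1 <= k < m.+1 | rough y k) 1.

Lemma divn_natr_err m d (s : R) : (0 < d)%N -> 0 < s <= 1 ->
  m%:R / d%:R * s - 1 <= (m %/ d)%N%:R * s <= m%:R / d%:R * s.
Proof.
move=> d0 /andP[s0 s1]; have d0R : 0 < d%:R :> R by rewrite ltr0n.
rewrite ler_pM2r // ler_pdivlMr // -natrM ler_nat leq_divM andbT lerBlDr.
apply: (@le_trans _ _ ((m %/ d).+1%:R * s)).
  by rewrite ler_pM2r // ler_pdivrMr // -natrM ler_nat ltnW // ltn_ceil.
by rewrite -natr1 mulrDl mul1r lerD2l.
Qed.

(** A prime step subtracts the count for [m %/ y] from that for [m]. Both carry the old error [E]
    and the floor costs at most 1, so [E] becomes [2 * E + 1], a recurrence solved by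
    [2 ^+ y - 1]. *)
Lemma rough_count_err y m :
  `|rough_count y m - m%:R * sieve_density y| <= 2 ^+ y - 1.
Proof.
elim: y m => [|y IH] m.
  rewrite /rough_count /sieve_density [in X in _ * X]big_geq // mulr1.
  by rewrite sumr_const_nat subSS subn0 subrr normr0 expr0 subrr.
have e : 1 <= 2 ^+ y :> R by rewrite exprn_ege1 // ler1n.
rewrite sieve_densityS exprS; case: ifPn => py; last first.
  rewrite /rough_count sum_roughS_nprime //; apply: (le_trans (IH m)); lra.
have -> : rough_count y.+1 m = rough_count y m - rough_count y (m %/ y).
  by rewrite /rough_count (sum_roughS_prime _ _ py) addrK.
have /andP[h1 h2] := divn_natr_err m (prime_gt0 py) (sieve_density_itv y).
have := IH m; have := IH (m %/ y)%N.
set a := rough_count y m; set b := rough_count _ _.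
rewrite !ler_norml => /andP[b1 b2] /andP[a1 a2].
have -> : m%:R * (sieve_density y * (1 - y%:R^-1)) =
  m%:R * sieve_density y - m%:R / y%:R * sieve_density y by ring.
by apply/andP; split; lra.
Qed.

Definition harmonic_sum (m : nat) : R := \sum_(1 <= k < m.+1) k%:R^-1.

Lemma harmonic_sum_ge_ln m : ln (m.+1%:R) <= harmonic_sum m.
Proof.
elim: m => [|m IH]; first by rewrite ln1 /harmonic_sum big_geq.
rewrite /harmonic_sum big_nat_recr //= -/(harmonic_sum m).
have m0 : 0 < m.+1%:R :> R by rewrite ltr0n.
have -> : m.+2%:R = m.+1%:R * (1 + m.+1%:R^-1) :> R.
  by rewrite mulrDr mulr1 divff ?natr1 // gt_eqF.
have i0 : 0 < m.+1%:R^-1 :> R by rewrite invr_gt0.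
rewrite lnM ?posrE ?addr_gt0 //.
by apply: lerD => //; rewrite le_ln1Dx // (lt_trans _ i0) // ltrN10.
Qed.

(* Removing the multiples of a prime [p] from the [p]-rough integers up to [m]
   removes at most a proportion [1 / p] of their sum of reciprocals; after all
   primes up to [m] only the integer 1 is left. *)
Lemma sieve_density_harmonic m : sieve_density m.+1 * harmonic_sum m <= 1.
Proof.
pose B y : R := \sum_(1 <= k < m.+1 | rough y k) k%:R^-1.
have B1 : B m.+1 <= 1.
  rewrite /B big_mkcond /=; have [->|m0] := posnP m; first by rewrite big_geq.
  rewrite big_ltn // big_nat big1 => [|k /andP[k1 km]].
    by rewrite addr0 invr1; case: ifP.
  case: ifPn => // rk; have k0 : (0 < k <= m)%N by rewrite (ltnW k1) -ltnS.
  by move: k1; rewrite (rough_leq1 k0 rk).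
(* Cross-multiplied form of: [B y / sieve_density y] is nondecreasing in [y]. *)
have Bs y : B y * sieve_density y.+1 <= B y.+1 * sieve_density y.
  rewrite sieve_densityS; have /andP[s0 _] := sieve_density_itv y.
  case: ifPn => py; last by rewrite /B sum_roughS_nprime.
  rewrite mulrCA mulrC ler_pM2r //.
  suff h : B y <= B y.+1 + B y / y%:R.
    by rewrite mulrBr mulr1 lerBlDr.
  rewrite {1}/B (sum_roughS_prime _ _ py) lerD2l.
  under eq_bigr do rewrite natrM invfM mulrC.
  rewrite -mulr_suml; have /andP[i0 _] := prime_inv_itv py.
  rewrite ler_pM2r // /B [leRHS](big_cat_nat _ (n := (m %/ y).+1)) //=;
    last first.
    by rewrite ltnS leq_div.
  by rewrite lerDl sumr_ge0 // => *; rewrite invr_ge0.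
apply: le_trans B1.
suff h y : sieve_density y * B 0%N <= B y.
  by apply: le_trans (h _); rewrite /B /harmonic_sum le_eqVlt; apply/orP; left.
elim: y => [|y IH]; first by rewrite /sieve_density big_geq // mul1r.
have /andP[s0 _] := sieve_density_itv y.
have /andP[s1 _] := sieve_density_itv y.+1.
rewrite -(ler_pM2r s0); apply: le_trans (Bs y).
by rewrite mulrC mulrCA mulrC ler_pM2r // mulrC.
Qed.

Lemma sieve_density_ln y : (0 < y)%N -> sieve_density y * ln y%:R <= 1.
Proof.
case: y => // m _; apply: le_trans (sieve_density_harmonic m).
have /andP[s0 _] := sieve_density_itv m.+1.
by rewrite ler_pM2l // harmonic_sum_ge_ln.
Qed.

(** For prime [y] the drop of the sieve density is [sieve_density y / y], otherwise it is 0; this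
    form makes tails telescope. *)
Lemma density_partialS y : density_partial R y.+1 =
  density_partial R y + (sieve_density y - sieve_density y.+1) / (y%:R + 1).
Proof.
rewrite /density_partial big_mkcond big_nat_recr //= -big_mkcond; congr (_ + _).
rewrite sieve_densityS; case: ifP => py; last by rewrite subrr mul0r.
rewrite -/(sieve_density y) invfM; ring.
Qed.

Lemma density_partial_diff y m :
  0 <= density_partial R (y + m) - density_partial R y
    <= (sieve_density y - sieve_density (y + m)) / (y%:R + 1).
Proof.
elim: m => [|m /andP[h0 h1]]; first by rewrite addn0 !subrr mul0r lexx.
have dec k : sieve_density k.+1 <= sieve_density k.
  rewrite sieve_densityS; case: ifP => // /prime_inv_itv/andP[p0 _].
  by have /andP[s0 _] := sieve_density_itv k; rewrite ger_pMr // gerBl ltW.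
rewrite addnS density_partialS.
have hd := dec (y + m)%N.
have y0 : 0 < y%:R + 1 :> R by rewrite ltr_wpDl.
have ym0 : 0 < (y + m)%:R + 1 :> R by rewrite ltr_wpDl.
have t0 : 0 <=
    (sieve_density (y + m) - sieve_density (y + m).+1) / ((y + m)%:R + 1).
  by rewrite divr_ge0 ?subr_ge0 // ltW.
have t1 : (sieve_density (y + m) - sieve_density (y + m).+1) / ((y + m)%:R + 1)
   <= (sieve_density (y + m) - sieve_density (y + m).+1) / (y%:R + 1).
  by rewrite ler_wpM2l ?subr_ge0 // lef_pV2 ?posrE // lerD2r ler_nat leq_addr.
move: h1 t0 t1; rewrite !mulrBl => h1 t0 t1.
by apply/andP; split; lra.
Qed.

Lemma density_partial_nondecreasing : nondecreasing_seq (density_partial R).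
Proof.
move=> y m ym; have /andP[] := density_partial_diff y (m - y).
by rewrite subnKC // subr_ge0.
Qed.

(** Uniformity in [m] serves twice: it bounds the partial sums, hence gives convergence, and it
    bounds the tail beyond [y]. *)
Lemma density_partial_le y m :
  density_partial R m <= density_partial R y + sieve_density y / (y%:R + 1).
Proof.
have y0 : 0 < y%:R + 1 :> R by rewrite ltr_wpDl.
have /andP[s0 _] := sieve_density_itv y.
case: (leqP y m) => ym; last first.
  apply: le_trans (density_partial_nondecreasing (ltnW ym)) _.
  by rewrite lerDl divr_ge0 // ltW.
have /andP[_] := density_partial_diff y (m - y); rewrite subnKC //.
rewrite lerBlDl => /le_trans; apply; rewrite lerD2l ler_pM2r ?invr_gt0 //.
by rewrite gerBl; have /andP[/ltW] := sieve_density_itv m.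
Qed.

Lemma cvgn_density_partial : cvgn (density_partial R).
Proof.
apply: nondecreasing_is_cvgn; first exact: density_partial_nondecreasing.
exists (density_partial R 0 + sieve_density 0 / (0%:R + 1)) => _ [m _ <-].
exact: density_partial_le.
Qed.

Lemma density_bounds y : density_partial R y <= density R
   <= density_partial R y + sieve_density y / (y%:R + 1).
Proof.
rewrite nondecreasing_cvgn_le; first last.
- exact: cvgn_density_partial.
- exact: density_partial_nondecreasing.
apply: limr_le; first exact: cvgn_density_partial.
by apply: nearW => m; exact: density_partial_le.
Qed.

End Sieve.

(** * Remainders and their codivisors *)

(** The inequality is [n - N < N / pdiv N] with denominators cleared. The guard excludes 0 and 1,
    where [pdiv] takes the default value 1. *)
Definition remainder_codiv (n N : nat) : bool :=
  (1 < N)%N && (pdiv N * n < (pdiv N).+1 * N)%N.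

(* The codivisor [N = n - n %% k] has the divisor [k > n - N], and the largest
   proper divisor of [N] is [N %/ pdiv N]. *)
Lemma mem_remainders n m :
  (m \in remainders n) = (m <= n)%N && remainder_codiv n (n - m).
Proof.
rewrite mem_undup; apply/mapP/andP => [[k + ->]|[mn /andP[]]].
  rewrite mem_index_iota ltnS leq_divRL // => /andP[k0 kn].
  (* The bound [k <= n / 2] enters here: the quotient is at least 2, so it bounds the least prime
     factor of its multiple [n - n %% k]. *)
  have qn : (1 < n %/ k)%N by rewrite leq_divRL // mulnC.
  split; first exact: leq_mod.
  have eN : (n - n %% k = n %/ k * k)%N by rewrite {1}(divn_eq n k) addnK.
  have pq : (pdiv (n - n %% k) <= n %/ k)%N.
    by apply: pdiv_min_dvd => //; rewrite eN dvdn_mulr.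
  have rk := ltn_pmod n k0.
  rewrite /remainder_codiv; move: pq; rewrite eN.
  set p := pdiv _ => pq; have n1 : (1 < n %/ k * k)%N by nia.
  have p1 : (1 < p)%N := prime_gt1 (pdiv_prime n1).
  rewrite n1 /= {1}(divn_eq n k) mulnDr mulSn addnC ltn_add2r.
  apply: (@leq_trans (p * k)); last by rewrite leq_mul2r pq orbT.
  by rewrite ltn_pmul2l // ltnW.
set N := (n - m)%N => N1.
have eN := divnK (pdiv_dvd N); have p1 := prime_gt1 (pdiv_prime N1).
move: eN p1; set p := pdiv N; set k := (N %/ p)%N => eN p1 h.
have en : n = (N + m)%N by rewrite subnK.
have mk : (m < k)%N by move: h; rewrite -(ltn_pmul2l (ltnW p1)); nia.
(* The witness is the largest proper divisor of [N]; it is at most [n / 2] because [p >= 2]. *)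
exists k; last by rewrite en -eN mulnC modnMDl modn_small.
by rewrite mem_index_iota ltnS leq_divRL //; nia.
Qed.

(** The map sending [m] to [n - m] is a bijection from remainders to codivisors. *)
Lemma num_remaindersE n :
  num_remainders n = count (remainder_codiv n) (iota 1 n).
Proof.
rewrite -size_filter /num_remainders -(size_map (fun m => n - m)%N).
apply/perm_size/uniq_perm.
- rewrite map_inj_in_uniq ?undup_uniq // => a b.
  rewrite !mem_remainders => /andP[an _] /andP[bn _] /eqP.
  by rewrite eqn_sub2lE // => /eqP.
- by rewrite filter_uniq // iota_uniq.
move=> N; rewrite mem_filter mem_iota add1n ltnS; apply/mapP/and3P.
  move=> [m + ->]; rewrite mem_remainders => /andP[mn g].
  by move: (g) => /andP[g1 _]; rewrite leq_subr (ltnW g1).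
move=> [g N0 Nn]; exists (n - N)%N; last by rewrite subKn.
by rewrite mem_remainders leq_subr subKn.
Qed.

(** * Counting codivisors by least prime factor *)

Section Counting.
Variable R : realType.
Implicit Types y m n p : nat.

Definition rough_codiv_count (n y : nat) : R :=
  \sum_(1 <= N < n.+1 | rough y N) (remainder_codiv n N)%:R.

Lemma num_remainders_codiv n : (num_remainders n)%:R = rough_codiv_count n 0.
Proof.
rewrite num_remaindersE -sum1_count natr_sum /rough_codiv_count.
rewrite /index_iota subSS subn0 big_mkcond /=.
by apply: eq_bigr => k _; case: (remainder_codiv n k).
Qed.

Lemma rough_count_diff y a b : (a <= b)%N ->
  rough_count R y b - rough_count R y a =
  \sum_(1 <= k < b.+1 | rough y k) (a < k)%N%:R.
Proof.
move=> ab; rewrite /rough_count [X in X - _](big_cat_nat _ (n := a.+1)) //=.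
rewrite addrAC subrr add0r [RHS](big_cat_nat _ (n := a.+1)) //=.
rewrite [X in _ = X + _]big_nat_cond [X in _ = X + _]big1 ?add0r => [|k];
  last first.
  by move=> /andP[/andP[_ ka] _]; rewrite ltnNge -ltnS ka.
rewrite big_nat_cond [RHS]big_nat_cond.
by apply: eq_bigr => k /andP[/andP[-> _] _].
Qed.

(** The difference counts codivisors [p * j] with least prime factor exactly [p]. For these the
    codivisor condition reduces to [n < (p + 1) * j], so [j] runs over the [p]-rough integers in
    [(n / (p + 1), n / p]]. *)
Lemma rough_codiv_countS n p : prime p ->
  rough_codiv_count n p - rough_codiv_count n p.+1 =
  rough_count R p (n %/ p) - rough_count R p (n %/ p.+1).
Proof.
move=> pp; have p0 := prime_gt0 pp; have p1 := prime_gt1 pp.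
rewrite /rough_codiv_count (sum_roughS_prime _ _ pp) addrAC subrr add0r.
rewrite rough_count_diff ?leq_div2l // big_nat_cond [RHS]big_nat_cond.
apply: eq_bigr => j /andP[/andP[j0 _] rj]; congr (_%:R).
rewrite /remainder_codiv (@rough_dvd_pdiv p) ?rough_mul_prime ?dvdn_mulr //;
  last nia.
have -> : (1 < p * j)%N by nia.
by rewrite /= mulnCA ltn_pmul2l // ltn_divLR // mulnC.
Qed.

Lemma rough_count_divn_err y n d : (0 < d)%N ->
  `|rough_count R y (n %/ d) - n%:R / d%:R * sieve_density R y| <= 2 ^+ y.
Proof.
move=> d0; have /andP[h1 h2] := divn_natr_err n d0 (sieve_density_itv R y).
have := rough_count_err R y (n %/ d); move: h1 h2.
set u := _%:R / _ * _; set v := _%:R * sieve_density R y => h1 h2.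
rewrite !ler_norml => /andP[a1 a2]; apply/andP; split; lra.
Qed.

(** Each prime [p < y] contributes [n * sieve_density p * (1 / p - 1 / (p + 1))], its term of the
    series, with two sieve errors [2 ^+ p]; these sum geometrically. *)
Lemma num_remainders_small_primes n y :
  `|(num_remainders n)%:R - rough_codiv_count n y - n%:R * density_partial R y|
    <= 2 * 2 ^+ y.
Proof.
elim: y => [|y IH].
  rewrite num_remainders_codiv subrr /density_partial big_geq // mulr0 subrr.
  by rewrite normr0 expr0.
have e : 1 <= 2 ^+ y :> R by rewrite exprn_ege1 // ler1n.
rewrite density_partialS sieve_densityS exprS; case: ifPn => py; last first.
  rewrite subrr mul0r addr0 /rough_codiv_count sum_roughS_nprime //.
  apply: (le_trans IH); lra.
have y0 := prime_gt0 py.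
have := rough_codiv_countS n py.
have := rough_count_divn_err y n y0.
have := rough_count_divn_err y n (ltn0Sn y).
move: IH; rewrite !ler_norml => /andP[a1 a2] /andP[b1 b2] /andP[c1 c2] d.
have -> : n%:R * (density_partial R y + (sieve_density R y -
    sieve_density R y * (1 - y%:R^-1)) / (y%:R + 1)) =
  n%:R * density_partial R y + n%:R / y%:R * sieve_density R y -
  n%:R / y.+1%:R * sieve_density R y.
  have y1 : y%:R != 0 :> R by rewrite pnatr_eq0 -lt0n.
  have y2 : y%:R + 1 != 0 :> R by rewrite natr1 pnatr_eq0.
  by rewrite -natr1; field; rewrite y1 y2.
move: b1 b2 c1 c2; set u := n%:R / y.+1%:R * _; set v := n%:R / y%:R * _.
by move=> b1 b2 c1 c2; apply/andP; split; lra.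
Qed.

Lemma rough_codiv_count_le n y :
  0 <= rough_codiv_count n y
    <= n%:R / (y%:R + 1) * sieve_density R y + 2 * 2 ^+ y.
Proof.
rewrite {1}/rough_codiv_count sumr_ge0 //=.
have /andP[s0 s1] := sieve_density_itv R y.
(* Since [p / (p + 1)] increases with [p], a codivisor with least prime factor at least [y] exceeds
   [a]. *)
set a := (n * y %/ y.+1)%N.
have an : (a <= n)%N by rewrite -ltnS ltn_divLR //; nia.
apply: (@le_trans _ _ (rough_count R y n - rough_count R y a)).
  rewrite rough_count_diff //; apply: ler_sum => N rN.
  rewrite ler_nat; case g : (remainder_codiv n N) => //.
  rewrite lt0b ltn_divLR //.
  move/andP: g => [N1 g]; have yp := rough_leq_pdiv N1 rN.
  have p0 : (0 < pdiv N)%N by rewrite pdiv_gt0.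
  move: (pdiv N) yp g p0 => p yp g p0.
  by nia.
(* The case of divisor 1 gives the count up to [n] itself. *)
have := rough_count_divn_err y n (ltn0Sn 0); rewrite divn1 divr1.
have := rough_count_divn_err y (n * y) (ltn0Sn y).
rewrite -/a !ler_norml => /andP[b1 b2] /andP[c1 c2].
have -> : n%:R / (y%:R + 1) * sieve_density R y =
   n%:R * sieve_density R y - (n * y)%N%:R / y.+1%:R * sieve_density R y.
  have y2 : y%:R + 1 != 0 :> R by rewrite natr1 pnatr_eq0.
  by rewrite natrM -natr1; field; rewrite y2.
by move: b1 b2; set u := (n * y)%N%:R / y.+1%:R * _ => b1 b2; lra.
Qed.

(** The small primes and the rough codivisors each cost [2 * 2 ^+ y]; the rough codivisors and the
    tail of the series each add at most [n / ((y + 1) * ln y)]. *)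
Lemma num_remainders_err n y : (1 < y)%N ->
  `|(num_remainders n)%:R - density R * n%:R|
    <= 4 * 2 ^+ y + 2 * n%:R / ((y%:R + 1) * ln y%:R).
Proof.
move=> y1; have := num_remainders_small_primes n y.
have /andP[a1 a2] := rough_codiv_count_le n y.
have /andP[d1 d2] := density_bounds R y.
have l0 : 0 < ln y%:R :> R by rewrite ln_gt0 // ltr1n.
have yp : 0 < y%:R + 1 :> R by rewrite ltr_wpDl.
have S : n%:R / (y%:R + 1) * sieve_density R y <= n%:R / ((y%:R + 1) * ln y%:R).
  rewrite invfM mulrA ler_wpM2l //.
  by rewrite -[leRHS]mul1r ler_pdivlMr // sieve_density_ln // ltnW.
have e1 : density_partial R y * n%:R <= density R * n%:R by rewrite ler_wpM2r.
have e2 : density R * n%:R <= density_partial R y * n%:R +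
    n%:R / (y%:R + 1) * sieve_density R y.
  apply: (le_trans (ler_wpM2r (ler0n R n) d2)); rewrite mulrDl lerD2l.
  by rewrite le_eqVlt; apply/orP; left; apply/eqP; ring.
have e0 : 0 <= 2 ^+ y :> R by rewrite exprn_ge0.
rewrite -mulrA.
move: S; set u := n%:R / (_ * _).
set v := _ * sieve_density R y in a2 e2 * => S.
have v0 : 0 <= v.
  rewrite mulr_ge0 ?divr_ge0 // ?ltW //.
  by have /andP[] := sieve_density_itv R y.
rewrite !ler_norml [n%:R * _]mulrC => /andP[b1 b2].
apply/andP; split; lra.
Qed.

End Counting.

(** * Choice of the cut, error term and limit *)

Section Asymptotics.
Variable R : realType.

Lemma num_remainders_err_ln n : 6 <= ln n%:R :> R ->
  `|(num_remainders n)%:R - density R * n%:R|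
    <= 72 * (n%:R / (ln n%:R * ln (ln n%:R))).
Proof.
set L := ln n%:R => L6.
(* [ln] is 0 by default at nonpositive arguments, so [6 <= L] rules out [n = 0]. *)
have n0 : 0 < n%:R :> R.
  by rewrite ltNge; apply/negP => /ln0 h; move: L6; rewrite /L h; lra.
have L2 : 0 <= L / 2 by lra.
have := truncn_itv L2; set y := Num.truncn (L / 2) => /andP[yL Ly].
have y3 : (3 <= y)%N by rewrite truncn_ge_nat //; lra.
have lL0 : 0 < ln L by rewrite ln_gt0; lra.
have lLL : ln L <= L by apply/ltW/ln_sublinear; lra.
have yR3 : 3 <= y%:R :> R by rewrite ler_nat.
move: Ly; rewrite -[y.+1%:R]natr1 => Ly.
(* Equivalent to [L <= y ^ 2], which follows from [L < 2 * y + 2 <= 3 * y <= y ^ 2]. *)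
have lnL : ln L / 2 <= ln y%:R.
  rewrite ler_pdivrMr // mulr_natr -lnXn; last by lra.
  have L0 : 0 < L by lra.
  have y0 : 0 < y%:R :> R by lra.
  rewrite ler_ln ?posrE ?exprn_gt0 // expr2.
  have : 3 * y%:R <= y%:R * y%:R :> R by rewrite ler_pM2r.
  by move: (y%:R * y%:R) => z; lra.
apply: (le_trans (num_remainders_err R n (ltnW y3))).
have LlL : 0 < L * ln L by rewrite mulr_gt0 //; lra.
have h2 : 2 * n%:R / ((y%:R + 1) * ln y%:R) <= 8 * (n%:R / (L * ln L)).
  have -> : 8 * (n%:R / (L * ln L)) = 2 * n%:R / ((L / 2) * (ln L / 2)).
    by field; rewrite !gt_eqF //; lra.
  rewrite ler_pM2l ?mulr_gt0 // lef_pV2 ?posrE ?mulr_gt0 //; try lra.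
  by apply: ler_pM; lra.
have h1 : 2 ^+ y <= expR (L / 2).
  apply: (@le_trans _ _ (expR y%:R)); last by rewrite ler_expR.
  rewrite -[y%:R]mulr1 expRM_natl lerXn2r ?nnegrE ?expR_ge0 //.
  by have := expR_ge1Dx (1 : R); lra.
have eL : expR (L / 2) * expR (L / 2) = n%:R.
  by rewrite -expRD -splitr lnK.
(* From [ln L <= L] and [L / 4 <= expR (L / 4)], squared. *)
have e4 : L * ln L <= 16 * expR (L / 2).
  have := expR_ge1Dx (L / 4); have -> : expR (L / 2) = expR (L / 4) ^+ 2.
    by rewrite -expRM_natl; congr expR; field.
  rewrite expr2; clear -L6 lL0 lLL => h.
  apply: (@le_trans _ _ (L * L)); first by rewrite ler_pM2l //; lra.
  have -> : L * L = 16 * ((L / 4) * (L / 4)) by field.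
  by rewrite ler_pM2l //; apply: ler_pM; lra.
have h3 : expR (L / 2) <= 16 * (n%:R / (L * ln L)).
  rewrite mulrA ler_pdivlMr // -eL [16 * _]mulrCA ler_pM2l ?expR_gt0 //.
have -> : (72 : R) = 4 * 16 + 8 by ring.
rewrite [leRHS]mulrDl; apply: lerD => //.
by rewrite -mulrA ler_pM2l // (le_trans h1 h3).
Qed.

Lemma near_ln_natr_ge (A : R) : \forall n \near \oo, A <= ln (n%:R : R).
Proof.
near=> n; have h : expR A <= n%:R :> R by near: n; exact: nbhs_infty_ger.
by rewrite -ler_expR lnK // posrE (lt_le_trans (expR_gt0 A)).
Unshelve. all: by end_near. Qed.

Lemma num_remainders_bigO :
  (fun n : nat => (num_remainders n)%:R : R^o)
    = (fun n : nat => density R * n%:R : R^o)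
      +O_\oo (fun n : nat => n%:R / (ln n%:R * ln (ln n%:R)) : R^o).
Proof.
apply/eqaddOP; near=> k; near=> n.
have n6 : 6 <= ln (n%:R : R) by near: n; exact: near_ln_natr_ge.
apply: (le_trans (num_remainders_err_ln n6)).
(* The big-O is unfolded for all sufficiently large constants [k], so [k] may be taken above 72. *)
have k72 : 72 <= k by near: k; exact: nbhs_pinfty_ge.
have L0 : 0 <= ln (n%:R : R) := le_trans (ler0n R 6) n6.
have l0 : 0 <= ln (ln (n%:R : R)) := ln_ge0 (le_trans (ler1n R 6) n6).
apply: ler_pM => //; last exact: ler_norm.
by rewrite divr_ge0 // mulr_ge0.
Unshelve. all: by end_near. Qed.

Lemma num_remainders_cvg :
  (fun n : nat => (num_remainders n)%:R / n%:R : R) @ \oo --> density R.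
Proof.
apply/cvgrPdist_le => e e0; near=> n.
have n6 : 6 <= ln (n%:R : R) by near: n; exact: near_ln_natr_ge.
(* After division by [n] the error is [72 / (L * ln L)]; this bound and [ln L >= 1] bring it down to
   [e]. *)
have ne : 72 / e <= ln (n%:R : R) by near: n; exact: near_ln_natr_ge.
have nl : expR 1 <= ln (n%:R : R) by near: n; exact: near_ln_natr_ge.
have n0 : 0 < n%:R :> R.
  by rewrite ltNge; apply/negP => /ln0 h; move: n6; rewrite h; lra.
have := num_remainders_err_ln n6; rewrite distrC.
have -> : density R - (num_remainders n)%:R / n%:R =
   (density R * n%:R - (num_remainders n)%:R) / n%:R by field; rewrite gt_eqF.
rewrite normrM [`|_^-1|]gtr0_norm ?invr_gt0 // ler_pdivrMr //.
move=> /le_trans; apply.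
set L := ln n%:R in n6 ne nl *.
have L0 : 0 < L by lra.
have lL : 1 <= ln L by rewrite -ler_expR lnK.
rewrite mulrCA mulrC ler_pM2r // ler_pdivrMr ?mulr_gt0 //; last lra.
rewrite ler_pdivrMr // in ne; apply: (le_trans ne); rewrite mulrC ler_pM2l //.
by rewrite ler_peMr // ltW.
Unshelve. all: by end_near. Qed.

End Asymptotics.

(** * Certified numerical value of the constant *)

(* Lower and upper bounds, as integer multiples of [1 / D], for the sieve
   density and for the partial sum of the density. *)
Definition fixed_point_step (p : nat) (s : N * N * N * N) : N * N * N * N :=
  let '(a, b, c, d) := s in
  let q := N.of_nat p in
  if prime p then
    (a * (q - 1) / q, b * (q - 1) / q + 1,
     c + a / (q * (q + 1)), d + b / (q * (q + 1)) + 1)%num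
  else s.

Definition fixed_point (D : N) (y : nat) : N * N * N * N :=
  iteri y fixed_point_step (D, D, 0, 0)%num.

(** With denominators cleared, the tests read [0.22955 < c / D] and
    [(d + b / (y + 1)) / D < 0.22965], where [b / (y + 1)] accounts for the tail. *)
Definition density_check (D : N) (y : nat) : bool :=
  let '(a, b, c, d) := fixed_point D y in
  (4591 * D <? 2 * (10 * 10 * 10 * 10) * c)%num &&
  (2 * (10 * 10 * 10 * 10) * ((N.of_nat y + 1) * d + b)
     <? (N.of_nat y + 1) * (4593 * D))%num.

Section Numerics.
Variable R : realType.

Let nr (x : N) : R := (N.to_nat x)%:R.

Let nrD x z : nr (x + z)%num = nr x + nr z.
Proof. by rewrite /nr N2Nat.inj_add natrD. Qed.

Let nrM x z : nr (x * z)%num = nr x * nr z.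
Proof. by rewrite /nr N2Nat.inj_mul natrM. Qed.

Lemma natr_Ndiv (x q : N) : (0 < N.to_nat q)%N ->
  nr (x / q)%num <= nr x / nr q <= nr (x / q)%num + 1.
Proof.
move=> q0; have q0R : 0 < nr q by rewrite ltr0n.
have e := N.div_mod' x q; have l : (x mod q < q)%num by apply: N.mod_lt; lia.
move: (x / q)%num (x mod q)%num e l => k r e l.
have {e} e : N.to_nat x = (N.to_nat q * N.to_nat k + N.to_nat r)%N.
  by rewrite e N2Nat.inj_add N2Nat.inj_mul.
have {l} l : (N.to_nat r < N.to_nat q)%N by lia.
have h : (N.to_nat k * N.to_nat q <= N.to_nat x)%N by rewrite e mulnC leq_addr.
have h' : (N.to_nat x <= (N.to_nat k).+1 * N.to_nat q)%N.
  by rewrite e mulSn addnC mulnC leq_add2r ltnW.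
by rewrite ler_pdivlMr // ler_pdivrMr // natr1 -!natrM !ler_nat h h'.
Qed.

(** Division in [N] rounds down, which keeps lower bounds valid; the [+ 1] in the upper ones
    compensates for it. *)
Lemma fixed_pointP D y : let '(a, b, c, d) := fixed_point D y in
  (nr a <= nr D * sieve_density R y <= nr b) /\
  (nr c <= nr D * density_partial R y <= nr d).
Proof.
elim: y => [|y].
  by rewrite /= /sieve_density /density_partial !big_geq // mulr1 mulr0 !lexx.
rewrite /fixed_point /= -/(fixed_point D y).
case: (fixed_point D y) => [[[a b] c] d] [/andP[a1 b1] /andP[c1 d1]].
rewrite /= density_partialS sieve_densityS; case: ifPn => py; last first.
  by rewrite subrr mul0r addr0 a1 b1 c1 d1.
have y0 : 0 < y%:R :> R by rewrite ltr0n prime_gt0.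
have y1 : 0 < y%:R + 1 :> R by lra.
have eq : nr (N.of_nat y) = y%:R by rewrite /nr Nat2N.id.
have eq1 : nr (N.of_nat y - 1)%num = y%:R - 1.
  rewrite -eq; apply/eqP; rewrite eq_sym subr_eq -[1]/(nr 1) -nrD N.sub_add //.
  by have := prime_gt0 py; lia.
have yy0 : (0 < N.to_nat (N.of_nat y))%N by rewrite Nat2N.id prime_gt0.
have zz0 : (0 < N.to_nat (N.of_nat y * (N.of_nat y + 1))%num)%N.
  by have := prime_gt0 py; nia.
have /andP[h1 _] := natr_Ndiv (a * (N.of_nat y - 1)) yy0.
have /andP[_ h2] := natr_Ndiv (b * (N.of_nat y - 1)) yy0.
have /andP[h3 _] := natr_Ndiv a zz0.
have /andP[_ h4] := natr_Ndiv b zz0.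
move: h1 h2 h3 h4; rewrite !nrD !nrM !nrD eq eq1 -[nr 1]/(1 : R).
set M := sieve_density R y in a1 b1 *; set P := density_partial R y in c1 d1 *.
move=> h1 h2 h3 h4.
have y01 : 0 <= 1 - y%:R^-1 :> R.
  by have /andP[_ /ltW] := prime_inv_itv R py; rewrite subr_ge0.
have yz : 0 < y%:R * (y%:R + 1) :> R by rewrite mulr_gt0.
have eM z : z * (y%:R - 1) / y%:R = z * (1 - y%:R^-1) :> R.
  by field; rewrite gt_eqF.
have -> : nr D * (P + (M - M * (1 - y%:R^-1)) / (y%:R + 1)) =
   nr D * P + nr D * M / (y%:R * (y%:R + 1)).
  by field; rewrite !gt_eqF.
move: h1 h2; rewrite !eM mulrA => h1 h2.
have k1 := ler_wpM2r y01 a1; have k2 := ler_wpM2r y01 b1.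
have yz0 : 0 <= (y%:R * (y%:R + 1))^-1 :> R by rewrite invr_ge0 ltW.
have k3 := ler_wpM2r yz0 a1; have k4 := ler_wpM2r yz0 b1.
rewrite (le_trans h1 k1) (le_trans k2 h2) (lerD c1 (le_trans h3 k3)).
by rewrite -addrA (lerD d1 (le_trans k4 h4)).
Qed.

Lemma density_check_sound (D : N) (y : nat) : (0 < D)%num ->
  density_check D y -> `|density R - 2296 / 10 ^+ 4| < 1 / (2 * 10 ^+ 4).
Proof.
have nr_lt x z : (x < z)%num -> nr x < nr z by move=> xz; rewrite ltr_nat; lia.
move=> /nr_lt D0; rewrite /density_check.
have /andP[] := density_bounds R y; have := fixed_pointP D y.
case: (fixed_point D y) => [[[a b] c] d] [/andP[_ b1] /andP[c1 d1]].
move=> lo hi /andP[/N.ltb_lt/nr_lt + /N.ltb_lt/nr_lt]; rewrite !(nrD, nrM).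
rewrite -[nr 10]/(10 : R) -[nr 2]/(2 : R) -[nr 1]/(1 : R).
rewrite -[nr 4591]/(4591 : R) -[nr 4593]/(4593 : R).
have -> : nr (N.of_nat y) = y%:R by rewrite /nr Nat2N.id.
have -> : 2 * (10 * 10 * 10 * 10) = 2 * 10 ^+ 4 :> R by ring.
have t0 : 0 < 2 * 10 ^+ 4 :> R by rewrite mulr_gt0 // exprn_gt0.
set t := 2 * 10 ^+ 4 in t0 *; have y0 : 0 < y%:R + 1 :> R by rewrite ltr_wpDl.
move=> h1 h2.
have -> : 2296 / 10 ^+ 4 = 4592 / t :> R.
  by rewrite /t; field.
rewrite -(ltr_pM2l t0) -[X in X * `|_|](gtr0_norm t0) -normrM mulrBr.
rewrite !(mulrCA t) divff ?gt_eqF // !mulr1 ltr_norml.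
have lo' : nr c <= nr D * density R by rewrite (le_trans c1) // ler_pM2l.
have hi' : (y%:R + 1) * (nr D * density R) <= (y%:R + 1) * nr d + nr b.
  apply: (@le_trans _ _ ((y%:R + 1) * (nr D * density_partial R y) +
    nr D * sieve_density R y)); last by rewrite lerD // ler_pM2l.
  have -> : (y%:R + 1) * (nr D * density_partial R y) +
      nr D * sieve_density R y = (y%:R + 1) *
      (nr D * (density_partial R y + sieve_density R y / (y%:R + 1))).
    by field; rewrite gt_eqF.
  by rewrite !ler_pM2l.
rewrite ltrBrDr ltrBlDr; apply/andP; split.
  rewrite -(ltr_pM2l D0) (_ : -1 + 4592 = 4591); last by ring.
  by rewrite mulrC (lt_le_trans h1) // mulrCA ler_pM2l.
rewrite -(ltr_pM2l D0) -(ltr_pM2l y0) (_ : 1 + 4592 = 4593); last by ring.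
rewrite [X in _ < _ * X]mulrC; apply: le_lt_trans h2.
by rewrite !(mulrCA _ t) ler_pM2l.
Qed.

Lemma density_approx : `|density R - 2296 / 10 ^+ 4| < 1 / (2 * 10 ^+ 4).
Proof.
(* At 3000 the tail is below 0.00005, the required precision; the large scale [D] makes the
   accumulated rounding negligible. *)
apply: (@density_check_sound 10000000000 3000); first by [].
by vm_compute.
Qed.

End Numerics.

Theorem theorem2p1 (R : realType) :
  [/\ cvgn (density_partial R),
      `|density R - 2296 / 10 ^+ 4| < 1 / (2 * 10 ^+ 4),
      (fun n : nat => (num_remainders n)%:R : R^o)
        = (fun n : nat => density R * n%:R : R^o)
          +O_\oo (fun n : nat => n%:R / (ln n%:R * ln (ln n%:R)) : R^o)
    & (fun n : nat => (num_remainders n)%:R / n%:R : R) @ \oo --> density R].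
Proof.
split.
- exact: cvgn_density_partial.
- exact: density_approx.
- exact: num_remainders_bigO.
- exact: num_remainders_cvg.
Qed.
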